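(* Let $G$ be a compact Hausdorff group acting continuously on a compact Hausdorff $G$-space $X$. Then $${\rm g}_G(X)={\rm ind}_G(X).$$
   Context: Multi-joins: the topological join is $X\ast Y:=(X\times Y\times[0,1])/\sim$ with $(x,y,1)\sim(x',y,1)$ and $(x,y,0)\sim(x,y',0)$ for all $x,x'\in X$, $y,y'\in Y$. Set $E_0G:=G$ and $E_nG:=G\ast\cdots\ast G$ ($n+1$ copies), with the diagonal translation action of $G$. Schwarz genus: ${\rm g}_G(X)$ is the smallest integer $n\geq 0$ such that $X$ can be covered by open $G$-invariant subsets $U_0,U_1,\ldots,U_n$ with the property that for every $i=0,\ldots,n$ there exists a $G$-equivariant continuous map $U_i\to G$ (where $G$ acts on itself by translation); if no such $n$ exists, ${\rm g}_G(X)=\infty$. $G$-index: ${\rm ind}_G(X)$ is the minimal integer $n\geq 0$ such that there exists a $G$-equivariant continuous map $X\to E_nG$; if there is no such map for any $n$, ${\rm ind}_G(X)=\infty$. *)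

(* Defs.v *)
From HB Require Import structures.
From mathcomp Require Import all_boot all_order all_algebra.
From mathcomp Require Import generic_quotient.
From mathcomp Require Import all_classical all_reals all_analysis.

Set Implicit Arguments.
Unset Strict Implicit.
Unset Printing Implicit Defensive.

Import Order.TTheory GRing.Theory Num.Theory.
Import numFieldNormedType.Exports.

Local Open Scope classical_set_scope.
Local Open Scope quotient_scope.

HB.mixin Record Topological_isTopologicalGroup G of Topological G & Group G := {
  mulg_continuous : continuous (fun p : G * G => (p.1 * p.2)%g);
  invg_continuous : continuous (fun x : G => (x^-1)%g)
}.

#[short(type="topologicalGroupType")]
HB.structure Definition TopologicalGroup :=
  {G of Topological G & Group G & Topological_isTopologicalGroup G}.

Record continuous_action (G : topologicalGroupType) (X : topologicalType)
    (act : G -> X -> X) : Prop := ContinuousAction {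
  act1 : forall x, act 1%g x = x;
  actM : forall g h x, act (g * h)%g x = act g (act h x);
  act_continuous : continuous (fun p : G * X => act p.1 p.2)
}.

Section Join.
Context (R : realType) (X Y : topologicalType).

Local Notation cylinder := (X * Y * set_type `[0%R, 1%R : R])%type.

(* X is collapsed at t = 1 and Y is collapsed at t = 0. *)
Definition join_rel_bool (p q : cylinder) : bool :=
  [|| p == q,
      [&& val p.2 == 1%R, val q.2 == 1%R & p.1.2 == q.1.2] |
      [&& val p.2 == 0%R, val q.2 == 0%R & p.1.1 == q.1.1]].

Lemma join_rel_refl : reflexive join_rel_bool.
Proof. by move=> p; rewrite /join_rel_bool eqxx. Qed.

Lemma join_rel_sym : symmetric join_rel_bool.
Proof.
move=> p q; rewrite /join_rel_bool (eq_sym q p) (eq_sym q.1.2) (eq_sym q.1.1).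
by rewrite !(andbCA (val p.2 == _)).
Qed.

Lemma join_rel_trans : transitive join_rel_bool.
Proof.
move=> q p r /or3P[/eqP-> //|/and3P[p1 q1 /eqP e]|/and3P[p0 q0 /eqP e]].
- case/or3P => [/eqP<-|/and3P[_ r1 /eqP e']|/and3P[q0 _ _]].
  + by apply/or3P/Or32; rewrite p1 q1 e eqxx.
  + by apply/or3P/Or32; rewrite p1 r1 e e' eqxx.
  + by move: q0; rewrite (eqP q1) oner_eq0.
- case/or3P => [/eqP<-|/and3P[q1 _ _]|/and3P[_ r0 /eqP e']].
  + by apply/or3P/Or33; rewrite p0 q0 e eqxx.
  + by move: q1; rewrite (eqP q0) eq_sym oner_eq0.
  + by apply/or3P/Or33; rewrite p0 r0 e e' eqxx.
Qed.

Definition join_rel := EquivRel _ join_rel_refl join_rel_sym join_rel_trans.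

Definition join := {eq_quot join_rel}.
HB.instance Definition _ := Topological.copy join (quotient_topology join).
HB.instance Definition _ := Quotient.on join.

(* The diagonal action [x, y, t] |-> [g x, g y, t]; it is independent of the
   representative chosen by repr, see join_actE. *)
Definition join_act (G : Type) (actX : G -> X -> X) (actY : G -> Y -> Y)
    (g : G) (z : join) : join :=
  let p := repr z in \pi_join (actX g p.1.1, actY g p.1.2, p.2).

Lemma join_actE (G : Type) (actX : G -> X -> X) (actY : G -> Y -> Y) g
    (x : X) (y : Y) (t : `[0%R, 1%R : R]) :
  join_act actX actY g (\pi_join (x, y, t)) =
  \pi_join (actX g x, actY g y, t).
Proof.
apply/eqmodP; have /eqmodP : \pi_join (repr (\pi_join (x, y, t))) =
  \pi_join (x, y, t) by rewrite reprK.
move=> /or3P[/eqP-> /=|/and3P[/= p1 t1 /eqP->]|/and3P[/= p0 t0 /eqP->]].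
- exact: join_rel_refl.
- by apply/or3P/Or32; rewrite /= p1 t1 eqxx.
- by apply/or3P/Or33; rewrite /= p0 t0 eqxx.
Qed.

End Join.

(* The (n+1)-fold join, bracketed to the left: E_{n+1} G = E_n G * G. *)
Fixpoint EG (R : realType) (G : topologicalGroupType) (n : nat) :
    topologicalType :=
  if n is m.+1 then join R (EG R G m) G else G.

Fixpoint EG_act (R : realType) (G : topologicalGroupType) (n : nat) :
    G -> EG R G n -> EG R G n :=
  match n return G -> EG R G n -> EG R G n with
  | 0 => fun g x => (g * x)%g
  | m.+1 => join_act (@EG_act R G m) (fun g x => (g * x)%g)
  end.

(* The least n such that P n, or +oo if there is none. *)
Definition least_or_oo (P : nat -> Prop) : \bar nat :=
  match pselect (exists n, `[< P n >]) with
  | left exP => EFin (ex_minn exP)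
  | right _ => +oo%E
  end.

Section Invariants.
Context (G : topologicalGroupType) (X : topologicalType) (act : G -> X -> X).

Definition invariant_set (U : set X) : Prop :=
  forall g x, U x -> U (act g x).

(* An equivariant map U -> G is encoded by a function on X, of which only the
   restriction to U matters. *)
Definition genus_le (n : nat) : Prop :=
  exists U : 'I_n.+1 -> set X,
    \bigcup_i U i = [set: X] /\
    forall i, [/\ open (U i), invariant_set (U i) &
      exists f : X -> G, {within U i, continuous f} /\
        forall g x, U i x -> f (act g x) = (g * f x)%g].

Definition schwarz_genus : \bar nat := least_or_oo genus_le.

Definition index_le (R : realType) (n : nat) : Prop :=
  exists f : X -> EG R G n, continuous f /\
    forall g x, f (act g x) = EG_act g (f x).

Definition G_index (R : realType) : \bar nat := least_or_oo (index_le R).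

End Invariants.

(* Main.v *)
Require Import Defs.
From mathcomp Require Import all_boot all_order all_algebra.
From mathcomp Require Import generic_quotient.
From mathcomp Require Import all_classical all_reals all_analysis.

(** Both invariants are the least n with some property, and the two properties
    are equivalent for every n separately.

    From a map to an open cover: a point of the (n+1)-fold join has
    barycentric coordinates, and the sets where one coordinate is nonzero form
    an open invariant cover of it by n+1 sets, each of which projects
    equivariantly to the corresponding factor G
    ([EG_trivializing_cover]). Pulling this cover back along an equivariant
    map from X into the join gives the cover of X that the Schwarz genus asks
    for ([genus_le_of_index]).

    From an open cover to a map: a cover U_0, ..., U_n with equivariant maps
    f_i : U_i -> G is made into a family of invariant functions psi_i >= 0,
    vanishing off U_i and without common zero ([genus_partition]). They are
    sums of maxima of Urysohn functions over orbits; such a maximum is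
    invariant, and it is continuous because G is compact
    ([max_compact_continuous], [invariant_separation]). The map X -> E_nG with
    barycentric coordinates proportional to psi_i and vertices f_i is built one
    factor at a time,
      F_(m+1) x = [F_m x, f_(m+1) x, psi_(m+1) x / (psi_0 x + ... + psi_(m+1) x)],
    and is equivariant since the psi_i are invariant ([index_le_of_partition]).

    The delicate point is continuity at the ends of the join, where one of the
    two components of a point is collapsed and need not depend continuously on
    x. There the tube lemma applies: as the collapsed factor is compact, a
    neighbourhood of a collapsed point contains a whole tube around that factor
    ([pi_join_continuous]). *)

Import Order.TTheory GRing.Theory Num.Theory.
Import numFieldNormedType.Exports.

Local Open Scope classical_set_scope.
Local Open Scope quotient_scope.

Set Implicit Arguments.
Unset Strict Implicit.
Unset Printing Implicit Defensive.

(** * Continuity and compactness *)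

Lemma cvg_pair_nbhs (T : Type) (U V : topologicalType) (F : set_system T)
    {FF : Filter F} (f : T -> U) (g : T -> V) (u : U) (v : V) :
  f @ F --> u -> g @ F --> v -> (fun x => (f x, g x)) @ F --> (u, v).
Proof. exact: cvg_pair. Qed.

Lemma continuous_at_snd (T U V : topologicalType) (h : U -> V) (x : T) (u : U) :
  {for u, continuous h} -> (fun p : T * U => h p.2) @ (x, u) --> h u.
Proof.
move=> ch A /ch hA; exists (setT, h @^-1` A) => [|p [_]] //=.
by split; [exact: filterT|exact: hA].
Qed.

(** Compactness of K makes the family F (k, _) equicontinuous at each point, and
    the maximum over k then inherits the common modulus. *)
Lemma max_compact_continuous (R : realType) (K X : topologicalType) (k0 : K)
    (F : K * X -> R) :
  compact [set: K] -> continuous F ->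
  exists2 M : X -> R, continuous M &
    forall x, (forall k, F (k, x) <= M x)%R /\ exists k, M x = F (k, x).
Proof.
move=> cK cF.
have cFx x : continuous (fun k => F (k, x)).
  move=> k; apply: (@continuous_comp _ _ _ (fun k => (k, x)) F); last exact: cF.
  by apply: cvg_pair; [exact: cvg_id|exact: cvg_cst].
have /choice[c cmax] : forall x, exists c, forall k, (F (k, x) <= F (c, x))%R.
  move=> x.
  have [||c _ cP] := @compact_EVT_max K R (fun k => F (k, x)) setT _ cK.
  - by exists k0.
  - exact: continuous_subspaceT.
  - by exists c => k; apply: cP; rewrite inE.
exists (fun x => F (c x, x)) => x; last by split => //; exists (c x).
apply/cvgrPdist_le => /= e e0.
have /compact_near_coveringP /(_ X (nbhs x)
  (fun y k => `|F (k, x) - F (k, y)| <= e)%R _) := cK.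
move=> cov; have {}cov : \forall y \near x,
    [set: K] `<=` (fun k => `|F (k, x) - F (k, y)| <= e)%R.
  apply: cov => k _.
  have e20 : (0 < e / 2)%R by rewrite divr_gt0.
  have c1 : \forall p \near (k, x), (`|F (k, x) - F p| <= e / 2)%R.
    by have /cvgrPdist_le := cF (k, x); apply.
  have c2 : \forall k' \near k & y \near x, (`|F (k, x) - F (k', x)| <= e / 2)%R.
    have h : \forall k' \near k, (`|F (k, x) - F (k', x)| <= e / 2)%R.
      by have /cvgrPdist_le := cFx x k; apply.
    exact: (@cvg_fst _ _ (nbhs k) (nbhs x) _ _ h).
  apply: filterS2 c1 c2 => -[k' y] /= h1 h2.
  rewrite (le_trans (ler_distD (F (k, x)) _ _))// (splitr e) lerD//.
  by rewrite distrC.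
apply: filterS cov => y cov.
rewrite ler_norml; apply/andP; split.
  rewrite lerBrDr addrC; apply: le_trans (cmax x (c y)) => //.
  have := cov (c y) I; rewrite ler_norml => /andP[+ _].
  by rewrite lerBrDr addrC.
rewrite lerBlDr; have := cov (c x) I; rewrite ler_norml => /andP[_].
by rewrite lerBlDr => /le_trans; apply; rewrite lerD2l.
Qed.

(** Finite subcovers with the centres kept in a list, for a space that may be
    empty: the near-covering form of compactness, applied to the filter of all
    large enough lists. *)
Lemma compact_finite_cover (X : topologicalType) (Q : X -> set X) :
  compact [set: X] -> (forall x, nbhs x (Q x)) ->
  exists s : seq X, forall y, exists2 x, x \in s & Q x y.
Proof.
move=> /compact_near_coveringP cX nQ.
pose F : set_system (seq X) := filter_from [set: seq X]
  (fun s0 => [set s | forall x, x \in s0 -> x \in s]).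
have FF : Filter F.
  apply: filter_from_filter; first by exists [::].
  move=> s1 s2 _ _; exists (s1 ++ s2) => // s /= sub.
  by split => x xs; apply: sub; rewrite mem_cat xs ?orbT.
have [|s0 _ /(_ s0 (fun x xs => xs)) s0P] :=
  cX _ F (fun s y => exists2 x, x \in s & Q x y) FF.
  move=> x _; exists (Q x, [set s | forall z, z \in [:: x] -> z \in s]) => /=.
    by split; [exact: nQ|exists [:: x]].
  by move=> -[y s] /= [Qxy xs]; exists x => //; apply: xs; rewrite mem_head.
by exists s0 => y; exact: s0P.
Qed.

Lemma continuous_sum_seq (R : realType) (X : topologicalType) (I : Type)
    (s : seq I) (P : pred I) (h : I -> X -> R) :
  (forall i, continuous (h i)) ->
  continuous (fun x => \sum_(i <- s | P i) h i x)%R.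
Proof.
move=> ch x; elim: s => [|i s IHs].
  rewrite (_ : (fun _ => _) = cst 0%R); first exact: cvg_cst.
  by apply/funext => y; rewrite big_nil.
rewrite (_ : (fun _ => _) = fun y => ((if P i then h i y else 0) +
  \sum_(i <- s | P i) h i y)%R); last first.
  by apply/funext => y; rewrite big_cons; case: ifP; rewrite ?add0r.
apply: cvgD => //; case: (P i); [exact: ch|exact: cvg_cst].
Qed.

(** * The topology of the join *)

Section JoinTopology.
Context {R : realType} {X Y : topologicalType}.

Local Notation J := (join R X Y).
Local Notation I01 := (set_type `[0%R, 1%R : R]).

Lemma pi_join_eq1 (x x' : X) (y : Y) (t : I01) :
  val t = 1%R -> \pi_J (x, y, t) = \pi_J (x', y, t).
Proof. by move=> t1; apply/eqmodP/or3P/Or32; rewrite /= t1 !eqxx. Qed.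

Lemma pi_join_eq0 (x : X) (y y' : Y) (t : I01) :
  val t = 0%R -> \pi_J (x, y, t) = \pi_J (x, y', t).
Proof. by move=> t0; apply/eqmodP/or3P/Or33; rewrite /= t0 !eqxx. Qed.

Lemma join_rel_repr (p : X * Y * I01) :
  join_rel_bool (repr (\pi_J p)) p.
Proof. by apply/(@eqmodP _ (join_rel R X Y)); rewrite reprK. Qed.

(** The coordinates read off the representative chosen by [repr] do not depend
    on that choice: the parameter always, the left component away from
    parameter 1, the right one away from parameter 0. *)
Definition join_param (z : J) : R := val (repr z).2.
Definition join_left (z : J) : X := (repr z).1.1.
Definition join_right (z : J) : Y := (repr z).1.2.

Lemma join_param_pi p : join_param (\pi_J p) = val p.2.
Proof.
by have /or3P[/eqP/(congr1 snd)/(congr1 val)//|/and3P[/eqP + /eqP -> _]|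
  /and3P[/eqP + /eqP -> _]] := join_rel_repr p.
Qed.

Lemma join_left_pi p : val p.2 != 1%R -> join_left (\pi_J p) = p.1.1.
Proof.
rewrite /join_left; have /or3P[/eqP-> //|/and3P[_ -> //]|/and3P[_ _ /eqP//]] :=
  join_rel_repr p.
Qed.

Lemma join_right_pi p : val p.2 != 0%R -> join_right (\pi_J p) = p.1.2.
Proof.
rewrite /join_right; have /or3P[/eqP-> //|/and3P[_ _ /eqP//]|/and3P[_ -> //]] :=
  join_rel_repr p.
Qed.

Lemma val01_continuous : continuous (fun p : X * Y * I01 => val p.2).
Proof.
move=> p; apply: (@continuous_comp _ I01 R snd val); first exact: cvg_snd.
exact: initial_continuous.
Qed.

Lemma join_param_continuous : continuous join_param.
Proof.
apply/quotient_continuous; rewrite (_ : _ \o _ = fun p => val p.2).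
  exact: val01_continuous.
by apply/funext => p; exact: join_param_pi.
Qed.

Lemma open_join_param_neq r : open [set z | join_param z != r].
Proof.
rewrite (_ : mkset _ = join_param @^-1` [set s | s != r])//.
apply: open_comp; last exact: num_normedtype.open_neq.
by move=> z _; exact: join_param_continuous.
Qed.

(** The part of the join with parameter different from 1 has an open preimage
    in the cylinder, and there the preimage of a set of left components is
    cut out by the first projection; openness in a quotient is openness of
    the preimage. *)
Lemma join_left_continuous z :
  join_param z != 1%R -> {for z, continuous join_left}.
Proof.
move=> z1 A /=; rewrite nbhsE => -[B [oB Bz] BA].
exists [set w | join_param w != 1%R /\ B (join_left w)]; split => //=; last first.
  by move=> w [_ /BA].
rewrite /open /= /quotient_open (_ : _ @^-1` _ =
    (fun p => val p.2) @^-1` [set s | s != 1%R] `&` (fst \o fst) @^-1` B).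
  apply: openI; first by apply: open_comp;
    [move=> p _; exact: val01_continuous|exact: num_normedtype.open_neq].
  apply: open_comp => // p _.
  by apply: (@cvg_comp _ _ _ fst fst); exact: cvg_fst.
apply/seteqP; split => p /=; rewrite join_param_pi => -[p1];
  by rewrite join_left_pi.
Qed.

Lemma join_right_continuous z :
  join_param z != 0%R -> {for z, continuous join_right}.
Proof.
move=> z0 A /=; rewrite nbhsE => -[B [oB Bz] BA].
exists [set w | join_param w != 0%R /\ B (join_right w)]; split => //=; last first.
  by move=> w [_ /BA].
rewrite /open /= /quotient_open (_ : _ @^-1` _ =
    (fun p => val p.2) @^-1` [set s | s != 0%R] `&` (snd \o fst) @^-1` B).
  apply: openI; first by apply: open_comp;
    [move=> p _; exact: val01_continuous|exact: num_normedtype.open_neq].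
  apply: open_comp => // p _.
  by apply: (@cvg_comp _ _ _ fst snd); [exact: cvg_fst|exact: cvg_snd].
apply/seteqP; split => p /=; rewrite join_param_pi => -[p1];
  by rewrite join_right_pi.
Qed.

(** Compactness passes from the segment in R to the same segment as a
    subtype: a filter-indexed property of the subtype is tested on reals by
    quantifying over the elements with a given value. *)
Lemma I01_compact : compact [set: I01].
Proof.
apply/compact_near_coveringP => K F P FF cov.
have cover r : (`[0%R, 1%R] : set R) r ->
    \forall r' \near r & k \near F, forall s : I01, val s = r' -> P k s.
  move=> r01; pose s0 : I01 := exist _ r (mem_set r01).
  have [[A B] /= [[_ [[V oV <-] Vr VA]] FB] AB] := cov s0 I.
  exists (V, B) => /=; first by split => //; exact: open_nbhs_nbhs.
  move=> [r' k] /= [Vr' Bk] s sr; apply: (AB (s, k)); split => //.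
  by apply: VA; move: Vr'; rewrite -sr.
have /compact_near_coveringP/(_ K F _ FF cover) :=
  @segment_compact R 0%R 1%R.
by apply: filterS => k Pk s _; apply: Pk (erefl (val s)); exact/set_mem/valP.
Qed.

Lemma I01_continuous_at (Z : topologicalType) (t : Z -> I01) z :
  {for z, continuous (fun w => val (t w))} -> {for z, continuous t}.
Proof.
move=> ct A /= [_ [[V oV <-] /= Vz] VA]; apply: filterS VA _.
exact: ct _ (open_nbhs_nbhs (conj oV Vz)).
Qed.

Lemma join_compact : compact [set: X] -> compact [set: Y] -> compact [set: J].
Proof.
move=> cX cY; have : compact [set: X * Y * I01].
  by rewrite -!setXTT; do 2?apply: compact_setX => //; exact: I01_compact.
move=> /(continuous_compact (continuous_subspaceT (@pi_continuous _ J))).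
congr compact; apply/seteqP; split => // z _.
by exists (repr z) => //; rewrite reprK.
Qed.

(** A component is only required to be continuous where it is not collapsed.
    Where it is collapsed, compactness of its factor gives the tube lemma: a
    neighbourhood of the collapsed point contains all values of that
    component. *)
Lemma pi_join_continuous (Z : topologicalType) (a : Z -> X) (b : Z -> Y)
    (t : Z -> I01) z :
  compact [set: X] -> compact [set: Y] ->
  {for z, continuous t} ->
  (val (t z) != 1%R -> {for z, continuous a}) ->
  (val (t z) != 0%R -> {for z, continuous b}) ->
  {for z, continuous (fun z => \pi_J (a z, b z, t z))}.
Proof.
move=> cX cY ct ca cb A /=; rewrite nbhsE => -[B [oB Bz] BA].
rewrite nbhs_simpl /=.
suff : \forall w \near z, B (\pi_J (a w, b w, t w)) by apply: filterS => w /BA.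
have cpi p : B (\pi_J p) -> \forall q \near p, B (\pi_J q).
  by move=> Bp; apply: (@pi_continuous _ J); exact: open_nbhs_nbhs.
have [t1|t1] := eqVneq (val (t z)) 1%R.
  have {}cb : {for z, continuous b} by apply: cb; rewrite t1 oner_eq0.
  have /compact_near_coveringP /(_ Z (nbhs z)
      (fun w x => B (\pi_J (x, b w, t w))) _) := cX.
  move=> cov; have {}cov : \forall w \near z,
      [set: X] `<=` (fun x => B (\pi_J (x, b w, t w))).
    apply: cov => x _.
    have Bx : B (\pi_J (x, b z, t z)) by rewrite (pi_join_eq1 _ (a z)).
    have cq : (fun p : X * Z => (p.1, b p.2, t p.2)) @ (x, z) -->
        (x, b z, t z).
      apply: cvg_pair_nbhs; last exact: continuous_at_snd ct.
      by apply: cvg_pair_nbhs; [exact: cvg_fst|exact: continuous_at_snd cb].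
    exact: cq _ (cpi _ Bx).
  by apply: filterS cov => w; exact.
have {}ca := ca t1.
have [t0|t0] := eqVneq (val (t z)) 0%R.
  have /compact_near_coveringP /(_ Z (nbhs z)
      (fun w y => B (\pi_J (a w, y, t w))) _) := cY.
  move=> cov; have {}cov : \forall w \near z,
      [set: Y] `<=` (fun y => B (\pi_J (a w, y, t w))).
    apply: cov => y _.
    have By : B (\pi_J (a z, y, t z)) by rewrite (pi_join_eq0 _ _ (b z)).
    have cq : (fun p : Y * Z => (a p.2, p.1, t p.2)) @ (y, z) -->
        (a z, y, t z).
      apply: cvg_pair_nbhs; last exact: continuous_at_snd ct.
      by apply: cvg_pair_nbhs; [exact: continuous_at_snd ca|exact: cvg_fst].
    exact: cq _ (cpi _ By).
  by apply: filterS cov => w; exact.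
have {}cb := cb t0.
have cq : (fun w => (a w, b w, t w)) @ z --> (a z, b z, t z).
  by apply: cvg_pair_nbhs => //; exact: cvg_pair_nbhs.
exact: cq _ (cpi _ Bz).
Qed.

End JoinTopology.

(** * Invariant functions subordinate to an invariant cover *)

Section Actions.
Context {R : realType} {G : topologicalGroupType} {X : topologicalType}.
Context {act : G -> X -> X}.
Context (act_action : continuous_action act).

Lemma actK g : cancel (act g) (act g^-1%g).
Proof. by move=> x; rewrite -(actM act_action) mulVg (act1 act_action). Qed.

Lemma invariant_setE (U : set X) g x :
  invariant_set act U -> U (act g x) -> U x.
Proof. by move=> invU /(invU g^-1%g); rewrite actK. Qed.

(** Take the maximum over each orbit of a Urysohn function that separates [x0]
    from the complement of [U]. It vanishes off [U] because that complement is
    a union of orbits. *)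
Lemma invariant_separation (U : set X) x0 :
  compact [set: G] -> compact [set: X] -> hausdorff_space X ->
  open U -> invariant_set act U -> U x0 ->
  exists psi : X -> R, [/\ continuous psi, (forall x, 0 <= psi x)%R,
    (forall g x, psi (act g x) = psi x), (forall x, psi x != 0%R -> U x) &
    (0 < psi x0)%R].
Proof.
move=> cG cX hX oU invU Ux0.
have : uniform_separator (~` U) [set x0].
  apply: (normal_separatorP (R := R)).1 => //.
  - exact: compact_normal.
  - exact: open_closedC.
  - exact/accessible_closed_set1/hausdorff_accessible.
  - by rewrite -subset0 => x [/= nUx xx0]; apply: nUx; rewrite xx0.
move=> /(uniform_separatorP (R := R))[phi [cphi phi01 phi0 phi1]].
have [M cM MP] : exists2 M : X -> R, continuous M &
    forall x, (forall g, phi (act g x) <= M x)%R /\ exists g, M x = phi (act g x).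
  apply: (@max_compact_continuous _ _ _ 1%g (fun p => phi (act p.1 p.2))) => //.
  move=> p; apply: (@continuous_comp _ _ _ (fun p => act p.1 p.2) phi).
    exact: (act_continuous act_action).
  exact: cphi.
have phi_ge0 x : (0 <= phi x)%R.
  by have := phi01 (phi x) (ex_intro2 _ _ x I erefl); rewrite /= in_itv => /andP[].
have le_M_act g x : (M (act g x) <= M x)%R.
  have [_ [h ->]] := MP (act g x).
  by rewrite -(actM act_action); exact: (MP x).1.
exists M; split => //.
- by move=> x; have [_ [g ->]] := MP x.
- by move=> g x; apply/le_anti; rewrite le_M_act -{1}(actK g x) le_M_act.
- move=> x; have [_ [g ->]] := MP x => phi_neq0.
  apply: (@invariant_setE _ g _ invU); apply: contrapT => nU.
  by move/eqP: phi_neq0; apply; apply: phi0; exists (act g x).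
- have := (MP x0).1 1%g; rewrite (act1 act_action); apply: lt_le_trans.
  by rewrite (phi1 (phi x0)) ?ltr01//; exists x0.
Qed.

(** An unnormalised invariant partition of unity subordinate to the cover:
    finitely many of the functions of [invariant_separation] have no common
    zero, and those that belong to the same member of the cover are added up.
    The indices are natural numbers, so that the join can be built by recursion
    on them; past [n], [inord] repeats the index 0. *)
Lemma genus_partition n :
  compact [set: G] -> compact [set: X] -> hausdorff_space X ->
  genus_le act n ->
  exists (psi : nat -> X -> R) (f : nat -> X -> G),
    [/\ forall i, continuous (psi i), forall i x, (0 <= psi i x)%R,
        forall i g x, psi i (act g x) = psi i x,
        forall i x, psi i x != 0%R -> {for x, continuous (f i)} /\
          forall g, f i (act g x) = (g * f i x)%g &
        forall x, exists2 i, (i <= n)%N & psi i x != 0%R].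
Proof.
move=> cG cX hX [U [covU UP]].
(* [w x] is a member of the cover around [x], paired with a function that is
   supported in it and positive at [x]. *)
have /choice[w wP] : forall x, exists w : 'I_n.+1 * (X -> R),
    [/\ continuous w.2, (forall y, 0 <= w.2 y)%R,
      (forall g y, w.2 (act g y) = w.2 y), (forall y, w.2 y != 0%R -> U w.1 y) &
      (0 < w.2 x)%R].
  move=> x; have [i _ Uix] : (\bigcup_i U i) x by rewrite covU.
  have [oU invU _] := UP i.
  by have [psi psiP] := invariant_separation cG cX hX oU invU Uix;
    exists (i, psi).
have [s sP] : exists s : seq X, forall y, exists2 x, x \in s & (0 < (w x).2 y)%R.
  apply: (@compact_finite_cover _ (fun x => [set y | (0 < (w x).2 y)%R])) => //.
  move=> x; have [cw _ _ _ wx] := wP x.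
  exact: (cw x _ (open_nbhs_nbhs (conj (@open_gt R 0%R) wx))).
have /choice[f fP] : forall i, exists f : X -> G, {within U i, continuous f} /\
    forall g x, U i x -> f (act g x) = (g * f x)%g by move=> i; have [] := UP i.
exists (fun i y => \sum_(x <- s | (w x).1 == inord i) (w x).2 y)%R, (f \o inord).
have w_ge0 x y : (0 <= (w x).2 y)%R by have [] := wP x.
split=> [i|i y|i g y|i y|y].
- by apply: (@continuous_sum_seq R X) => x; have [] := wP x.
- exact: sumr_ge0.
- by apply: eq_bigr => x _; have [_ _ ->] := wP x.
- rewrite psumr_neq0// => /hasP[x _ /andP[/eqP wx]].
  have [_ _ _ wU _] := wP x.
  move=> /lt0r_neq0/wU; rewrite wx => Uy; have [oU _ _] := UP (inord i).
  have [cf fact] := fP (inord i); split; last by move=> g; exact: fact.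
  move: cf; rewrite continuous_open_subspace// => /(_ y).
  by apply; rewrite inE.
- have [x xs wxy] := sP y; exists (w x).1; first by rewrite -ltnS.
  rewrite psumr_neq0//; apply/hasP; exists x => //.
  by rewrite inord_val eqxx.
Qed.

End Actions.

(** * Maps into the iterated join from invariant functions *)

Section PartitionToMap.
Context {R : realType} {G : topologicalGroupType}.

Lemma EG_compact n : compact [set: G] -> compact [set: EG R G n].
Proof. by move=> cG; elim: n => //= n IHn; exact: join_compact. Qed.

(** The recursion of the introduction, carried out on the set where the partial
    sum of the psi_i is nonzero: a point where the new parameter is not 1 has
    already a nonzero earlier sum, and one where it is not 0 has a nonzero new
    function, so a component is well behaved whenever it is not collapsed. *)
Lemma index_le_of_partition (X : topologicalType) (act : G -> X -> X)
    (psi : nat -> X -> R) (f : nat -> X -> G) n :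
  compact [set: G] ->
  (forall i, continuous (psi i)) -> (forall i x, (0 <= psi i x)%R) ->
  (forall i g x, psi i (act g x) = psi i x) ->
  (forall i x, psi i x != 0%R -> {for x, continuous (f i)} /\
    forall g, f i (act g x) = (g * f i x)%g) ->
  (forall x, exists2 i, (i <= n)%N & psi i x != 0%R) ->
  index_le act R n.
Proof.
move=> cG cpsi psi_ge0 psi_inv fP psi_cover.
pose S m x : R := (\sum_(0 <= i < m.+1) psi i x)%R.
have S_ge0 m x : (0 <= S m x)%R by apply: sumr_ge0.
have S_rec m x : S m.+1 x = (S m x + psi m.+1 x)%R by rewrite /S big_nat_recr.
suff [F FP] : exists F : X -> EG R G n, forall x, S n x != 0%R ->
    {for x, continuous F} /\ forall g, F (act g x) = EG_act g (F x).
  have S_neq0 x : S n x != 0%R.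
    have [i ni psii] := psi_cover x.
    rewrite psumr_neq0//; apply/hasP; exists i; first by rewrite mem_index_iota.
    by rewrite /= lt_def psii psi_ge0.
  by exists F; split => [x|g x]; have [] := FP _ (S_neq0 x).
elim: n {psi_cover} => [|m [F FP]].
  exists (f 0%N) => x; rewrite /S big_nat1 => /fP[cf fact].
  by split => // g; rewrite fact.
(* Where the sum vanishes the quotient is 0, so the parameter is in [0, 1] on
   all of X. *)
have t01 x : (`[0%R, 1%R] : set R) (psi m.+1 x / S m.+1 x)%R.
  rewrite /= in_itv /= divr_ge0//=.
  have [->|S0] := eqVneq (S m.+1 x) 0%R; first by rewrite invr0 mulr0.
  by rewrite ler_pdivrMr ?lt_def ?S0 ?S_ge0// mul1r S_rec lerDr.
pose t x : set_type `[0%R, 1%R : R] :=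
  exist _ (psi m.+1 x / S m.+1 x)%R (mem_set (t01 x)).
exists (fun x => \pi_(join R (EG R G m) G) (F x, f m.+1 x, t x)) => x Sx.
have ct : {for x, continuous t}.
  apply: I01_continuous_at; apply: cvgM; first exact: cpsi.
  by apply: cvgV => //; exact: continuous_sum_seq.
have F_good : val (t x) != 1%R -> S m x != 0%R.
  apply: contraNN => /eqP S0 /=.
  by move: Sx; rewrite S_rec S0 add0r => ?; rewrite divff.
have f_good : val (t x) != 0%R -> psi m.+1 x != 0%R.
  by apply: contraNN => /eqP p0 /=; rewrite p0 mul0r.
split.
  apply: pi_join_continuous => //.
  - exact: EG_compact.
  - by move=> /F_good/FP[].
  - by move=> /f_good/fP[].
move=> g; have -> : t (act g x) = t x.
  by apply: val_inj; rewrite /= psi_inv /S; under eq_bigr do rewrite psi_inv.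
rewrite /= join_actE.
have [t1|t1] := eqVneq (val (t x)) 1%R.
  have t0 : val (t x) != 0%R by rewrite t1 oner_eq0.
  have [_ ->] := fP _ _ (f_good t0).
  exact: pi_join_eq1.
have [_ ->] := FP _ (F_good t1).
have [t0|t0] := eqVneq (val (t x)) 0%R; first exact: pi_join_eq0.
by have [_ ->] := fP _ _ (f_good t0).
Qed.

End PartitionToMap.

(** * The trivializing cover of the iterated join *)

Section TrivializingCover.
Context {R : realType} {G : topologicalGroupType}.

Lemma join_param_act (X Y : topologicalType) (aX : G -> X -> X)
    (aY : G -> Y -> Y) g (z : join R X Y) :
  join_param (join_act aX aY g z) = join_param z.
Proof.
by rewrite -[z]reprK; case: (repr z) => -[x y] t; rewrite join_actE !join_param_pi.
Qed.

Lemma join_left_act (X Y : topologicalType) (aX : G -> X -> X)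
    (aY : G -> Y -> Y) g (z : join R X Y) : join_param z != 1%R ->
  join_left (join_act aX aY g z) = aX g (join_left z).
Proof.
rewrite -[z]reprK; case: (repr z) => -[x y] t; rewrite join_actE join_param_pi.
by move=> t1; rewrite !join_left_pi.
Qed.

Lemma join_right_act (X Y : topologicalType) (aX : G -> X -> X)
    (aY : G -> Y -> Y) g (z : join R X Y) : join_param z != 0%R ->
  join_right (join_act aX aY g z) = aY g (join_right z).
Proof.
rewrite -[z]reprK; case: (repr z) => -[x y] t; rewrite join_actE join_param_pi.
by move=> t1; rewrite !join_right_pi.
Qed.

(** In the join of E_nG and G, the sets for E_nG are transported along the left
    component to the part with parameter different from 1, and the part with
    parameter different from 0 is added, with the right component as its map
    to G. *)
Lemma EG_trivializing_cover n :
  exists (U : nat -> set (EG R G n)) (f : nat -> EG R G n -> G),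
  (forall z, exists2 i, (i <= n)%N & U i z) /\
  forall i, [/\ open (U i), invariant_set (@EG_act R G n) (U i),
    (forall z, U i z -> {for z, continuous (f i)}) &
    forall g z, U i z -> f i (EG_act g z) = (g * f i z)%g].
Proof.
elim: n => [|n [U [f [covU UP]]]].
  exists (fun=> setT), (fun=> id); split; first by move=> z; exists 0%N.
  by move=> i; split => // [|z _]; [exact: openT|exact: cvg_id].
pose J := join R (EG R G n) G.
exists (fun i => if i == n.+1 then [set z : J | join_param z != 0%R]
  else [set z : J | join_param z != 1%R] `&` join_left @^-1` U i).
exists (fun i => if i == n.+1 then @join_right R (EG R G n) G
  else f i \o @join_left R (EG R G n) G).
split=> [z|i].
  have [z0|z0] := eqVneq (@join_param R (EG R G n) G z) 0%R.
    have [i ni Ui] := covU (join_left (z : J)).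
    exists i; first exact: leqW.
    by rewrite ltn_eqF//; split => //=; rewrite /= z0 eq_sym oner_eq0.
  by exists n.+1; rewrite ?eqxx.
case: ifPn => _; split.
- exact: open_join_param_neq.
- by move=> g z; rewrite /= join_param_act.
- by move=> z; exact: join_right_continuous.
- by move=> g z; exact: join_right_act.
- have [oU _ _ _] := UP i.
  rewrite openE => z [z1 Uz]; apply: filterI.
    by apply: open_nbhs_nbhs; split=> //; exact: open_join_param_neq.
  by apply: (join_left_continuous z1); exact: open_nbhs_nbhs.
- move=> g z [z1 Uz]; split; first by rewrite /= join_param_act.
  by rewrite /= join_left_act//; have [_ invU _ _] := UP i; exact: invU.
- move=> z [z1 Uz]; apply: continuous_comp; first exact: join_left_continuous.
  by have [_ _ + _] := UP i; apply.
- move=> g z [z1 Uz]; rewrite /= join_left_act//.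
  by have [_ _ _ ->] := UP i.
Qed.

Lemma genus_le_of_index (X : topologicalType) (act : G -> X -> X) n :
  index_le act R n -> genus_le act n.
Proof.
move=> [F [cF Fact]]; have [U [f [covU UP]]] := EG_trivializing_cover n.
exists (fun i : 'I_n.+1 => F @^-1` U i); split.
  apply/seteqP; split => // x _; have [i ni Ui] := covU (F x).
  by exists (Ordinal (ni : (i < n.+1)%N)).
move=> i; have [oU invU cf fact] := UP i.
have oFU : open (F @^-1` U i) by apply: open_comp => // x _; exact: cF.
split=> //.
  by move=> g x /= Ux; rewrite Fact; exact: invU.
exists (f i \o F); split; last by move=> g x /= Ux; rewrite Fact fact.
rewrite continuous_open_subspace// => x; rewrite inE => Ux.
by apply: continuous_comp; [exact: cF|exact: cf].
Qed.

End TrivializingCover.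

(** * The Schwarz genus equals the index *)

Unset Implicit Arguments.

Theorem proposition4p4 (R : realType) (G : topologicalGroupType)
    (X : topologicalType) (act : G -> X -> X)
    (G_compact : compact [set: G]) (G_hausdorff : hausdorff_space G)
    (X_compact : compact [set: X]) (X_hausdorff : hausdorff_space X)
    (act_action : continuous_action act) :
  schwarz_genus act = G_index act R.
Proof.
congr least_or_oo; apply/funext => n; apply/propext.
split; last exact: genus_le_of_index.
move=> /(genus_partition (R := R) act_action G_compact X_compact X_hausdorff).
move=> [psi [f [cpsi psi_ge0 psi_inv fP psi_cover]]].
exact: index_le_of_partition psi_ge0 psi_inv fP psi_cover.
Qed.
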